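(* Let $(\mathcal{H},d)$ be a Hadamard space, and let $f:\mathcal{H}\to(-\infty,\infty]$ and $f^n:\mathcal{H}\to(-\infty,\infty]$, $n\in\mathbb{N}$, be proper convex lower semicontinuous functions. For $\lambda>0$ let $f_\lambda$ and $f^n_\lambda$ be the Moreau-Yosida envelopes, and $J_\lambda$ and $J^n_\lambda$ the resolvents, of $f$ and $f^n$, respectively. If $f^n\to f$ in the sense of Mosco as $n\to\infty$, then $$\lim_{n\to\infty} f^n_\lambda(x)=f_\lambda(x)\quad\text{and}\quad \lim_{n\to\infty}J^n_\lambda(x)=J_\lambda(x)$$ for every $\lambda>0$ and every $x\in\mathcal{H}$.
   Context: A Hadamard space is a complete geodesic metric space $(\mathcal{H},d)$ such that $d(x,\gamma(t))^2\le(1-t)d(x,\gamma(0))^2+t\,d(x,\gamma(1))^2-t(1-t)d(\gamma(0),\gamma(1))^2$ for every $x\in\mathcal{H}$, every (constant-speed) geodesic $\gamma:[0,1]\to\mathcal{H}$ and every $t\in[0,1]$. A function $f:\mathcal{H}\to(-\infty,\infty]$ is convex if $f\circ\gamma$ is convex for every geodesic $\gamma:[0,1]\to\mathcal{H}$; it is proper if it is not identically $\infty$. For a proper convex lower semicontinuous $f$ and $\lambda>0$, the Moreau-Yosida envelope is $f_\lambda(x)=\min_{y\in\mathcal{H}}\left[f(y)+\frac1{2\lambda}d(x,y)^2\right]$, and the resolvent is $J_\lambda(x)=\arg\min_{y\in\mathcal{H}}\left[f(y)+\frac1{2\lambda}d(x,y)^2\right]$, for $x\in\mathcal{H}$ (the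 minimizer exists and is unique). Weak convergence: for a bounded sequence $(x_n)\subset\mathcal{H}$, the function $x\mapsto\limsup_{n\to\infty}d(x,x_n)^2$ has a unique minimizer on $\mathcal{H}$, called the asymptotic center of $(x_n)$. A bounded sequence $(x_n)$ weakly converges to $x\in\mathcal{H}$, written $x_n\stackrel{w}{\to}x$, if $x$ is the asymptotic center of each subsequence of $(x_n)$. Mosco convergence: $f^n\to f$ in the sense of Mosco if, for every $x\in\mathcal{H}$, (M1) $f(x)\le\liminf_{n\to\infty}f^n(x_n)$ whenever $x_n\stackrel{w}{\to}x$, and (M2) there exists a sequence $(y_n)\subset\mathcal{H}$ with $y_n\to x$ and $f^n(y_n)\to f(x)$. *)

(* Defs.v *)
From mathcomp Require Import all_boot all_order all_algebra.
From mathcomp Require Import all_classical all_reals all_analysis.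

Set Implicit Arguments.
Unset Strict Implicit.
Unset Printing Implicit Defensive.

Import Order.TTheory GRing.Theory Num.Theory.
Import numFieldNormedType.Exports.

Local Open Scope classical_set_scope.
Local Open Scope ring_scope.

Section Hadamard.
Context {R : realType} {H : metricType R}.

(* Constant-speed geodesics [0, 1] -> H. A path is a total function on R, of
   which only the values on [0, 1] are ever used. *)
Definition geodesic (gamma : R -> H) : Prop :=
  forall s t : R, 0 <= s <= 1 -> 0 <= t <= 1 ->
    mdist (gamma s) (gamma t) = `|s - t| * mdist (gamma 0) (gamma 1).

Definition convex_fun (f : H -> \bar R) : Prop :=
  forall gamma : R -> H, geodesic gamma ->
  forall s t l : R, 0 <= s <= 1 -> 0 <= t <= 1 -> 0 <= l <= 1 ->
    (f (gamma ((1 - l) * s + l * t)%R) <=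
       (1 - l)%:E * f (gamma s) + l%:E * f (gamma t))%E.

(* The first conjunct says that f takes its values in (-oo, +oo]. *)
Definition proper_fun (f : H -> \bar R) : Prop :=
  (forall x, f x != -oo%E) /\ (exists x, f x != +oo%E).

Definition argmin {T : Type} (g : T -> \bar R) : set T :=
  [set x | forall y, (g x <= g y)%E].

Definition moreau_objective (f : H -> \bar R) (lambda : R) (x y : H) : \bar R :=
  (f y + ((2 * lambda)^-1 * mdist x y ^+ 2)%:E)%E.

Definition moreau_envelope (f : H -> \bar R) (lambda : R) (x : H) : \bar R :=
  ereal_inf (range (moreau_objective f lambda x)).

(* In a Hadamard space, for f proper convex lower semicontinuous and lambda > 0,
   the argmin is a singleton; the default value x of xget is then irrelevant. *)
Definition resolvent (f : H -> \bar R) (lambda : R) (x : H) : H :=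
  xget x (argmin (moreau_objective f lambda x)).

Definition bounded_seq (u : nat -> H) : Prop :=
  exists (p : H) (M : R), forall n, mdist p (u n) <= M.

(* In a Hadamard space the minimizer is unique when u is bounded. *)
Definition asymptotic_center (u : nat -> H) (x : H) : Prop :=
  argmin (fun y => limn_esup (fun n => (mdist y (u n) ^+ 2)%:E)) x.

Definition weak_cvg (u : nat -> H) (x : H) : Prop :=
  bounded_seq u /\
  forall phi : nat -> nat, {homo phi : m n / (m < n)%N} ->
    asymptotic_center (u \o phi) x.

Definition mosco_cvg (fn : nat -> H -> \bar R) (f : H -> \bar R) : Prop :=
  forall x : H,
    (forall u : nat -> H, weak_cvg u x ->
       (f x <= limn_einf (fun n => fn n (u n)))%E) /\
    (exists y : nat -> H,
       y n @[n --> \oo] --> x /\ fn n (y n) @[n --> \oo] --> f x).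

End Hadamard.

Definition complete_metric {R : realType} (H : metricType R) : Prop :=
  forall u : nat -> H, cauchy (u n @[n --> \oo]) ->
    exists x : H, u n @[n --> \oo] --> x.

Definition geodesic_space {R : realType} (H : metricType R) : Prop :=
  forall x y : H, exists gamma : R -> H,
    [/\ geodesic gamma, gamma 0 = x & gamma 1 = y].

Definition hadamard_space {R : realType} (H : metricType R) : Prop :=
  [/\ complete_metric H,
      geodesic_space H &
      forall (x : H) (gamma : R -> H) (t : R), geodesic gamma -> 0 <= t <= 1 ->
        mdist x (gamma t) ^+ 2 <=
          (1 - t) * mdist x (gamma 0) ^+ 2 + t * mdist x (gamma 1) ^+ 2
          - t * (1 - t) * mdist (gamma 0) (gamma 1) ^+ 2].

(* Main.v *)
(** Recovery sequences (M2) give the upper bound for the envelopes. For the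
    lower bound, convexity turns the local lower bound implied by (M1) into
    [f^n >= - L (1 + d z)] uniformly in large [n], so that points violating the
    lower bound stay bounded. Among the infinite sets of indices one minimizes
    the asymptotic radius: on a minimal set all subsequences share their radius,
    hence their asymptotic center, which is a weak limit; (M1) and weak lower
    semicontinuity of the distance then give a contradiction. Finally the strong
    convexity of the objectives forces the resolvents to approach any recovery
    sequence of the limiting resolvent. *)
Require Import Defs.
From mathcomp Require Import all_boot all_order all_algebra.
From mathcomp Require Import all_classical all_reals all_analysis.
From mathcomp Require Import ring lra.

Set Implicit Arguments.
Unset Strict Implicit.
Unset Printing Implicit Defensive.

Import Order.TTheory GRing.Theory Num.Theory.
Import numFieldNormedType.Exports.

Local Open Scope classical_set_scope.
Local Open Scope ring_scope.

(** * Infinite sets of indices *)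

Definition infinitely_often (A : set nat) : Prop :=
  forall N, exists2 n, (N <= n)%N & A n.

Lemma infinitely_often_near (A P : set nat) :
  infinitely_often A -> (\forall n \near \oo, P n) -> exists2 n, A n & P n.
Proof.
by move=> iA [N _ NP]; have [n Nn An] := iA N; exists n => //; exact: NP.
Qed.

Lemma infinitely_often_sub {A B : set nat} :
  infinitely_often A -> (\forall n \near \oo, A n -> B n) -> infinitely_often B.
Proof.
move=> iA AB N; have [n An [Nn Bn]] : exists2 n, A n & ((N <= n)%N /\ (A n -> B n)).
  by apply: infinitely_often_near => //; near=> n; split; near: n => //; exact: nbhs_infty_ge.
by exists n => //; exact: Bn.
Unshelve. all: by end_near. Qed.

Lemma not_near_infinitely_often (P : set nat) :
  ~ (\forall n \near \oo, P n) -> infinitely_often (~` P).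
Proof.
move=> nP N; apply: contrapT => h; apply: nP; exists N => // n /= Nn.
by apply: contrapT => Pn; apply: h; exists n.
Qed.

Lemma increasing_geq {phi : nat -> nat} :
  {homo phi : m n / (m < n)%N} -> forall n, (n <= phi n)%N.
Proof.
by move=> hphi; elim=> // n /leq_ltn_trans; apply; exact: hphi.
Qed.

Lemma increasing_selection (B : nat -> set nat) :
  (forall k, infinitely_often (B k)) ->
  exists2 phi : nat -> nat, {homo phi : m n / (m < n)%N} & forall k, B k (phi k).
Proof.
move=> iB; have /choice[g gP] : forall kN : nat * nat,
    exists n, (kN.2 <= n)%N /\ B kN.1 n.
  by move=> [k N]; have [n] := iB k N; exists n.
pose phi := fix phi k := if k is j.+1 then g (k, (phi j).+1) else g (0%N, 0%N).
exists phi => [|[|k]]; last 2 first.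
- by have [] := gP (0%N, 0%N).
- by have [] := gP (k.+1, (phi k).+1).
by apply: homo_ltn => [? ? ? |n]; [exact: ltn_trans|have [] := gP (n.+1, (phi n).+1)].
Qed.

(** Picking one index from each [B k] in increasing order gives an infinite set. Its elements from
    [phi k] on were picked in some [B j] with [k <= j], hence lie in [B k]. *)
Lemma pseudo_intersection (B : nat -> set nat) :
  (forall k, infinitely_often (B k)) -> (forall k, B k.+1 `<=` B k) ->
  exists A : set nat, [/\ infinitely_often A, A `<=` B 0%N &
    forall k, \forall n \near \oo, A n -> B k n].
Proof.
move=> /increasing_selection[phi hphi Bphi] decB.
have decB' i j : (i <= j)%N -> B j `<=` B i.
  move=> /subnK <-; elim: (j - i)%N => [//|n ih].
  by rewrite addSn; exact: subset_trans (decB _) ih.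
exists (range phi); split.
- by move=> N; exists (phi N); [exact: increasing_geq|exists N].
- by move=> _ [k _ <-]; exact: decB' (Bphi k).
- move=> k; exists (phi k) => // n /= kn [j _ jn]; subst n.
  apply: (decB' _ j) (Bphi j); rewrite leqNgt; apply/negP => /hphi.
  by rewrite ltnNge kn.
Qed.

(* Diagonal argument: shrink [B] step by step, halting within [1 / k.+1] of the
   infimum of [r] over the infinite subsets, and take a pseudo-intersection. *)
Lemma minimal_infinitely_often {R : realType} (r : set nat -> R) (m : R)
    (B : set nat) :
  infinitely_often B -> (forall A, infinitely_often A -> m <= r A) ->
  (forall A C, infinitely_often A -> (\forall n \near \oo, A n -> C n) ->
     r A <= r C) ->
  exists A, [/\ infinitely_often A, A `<=` B &
    forall C, infinitely_often C -> C `<=` A -> r A <= r C].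
Proof.
move=> iB mr monor.
pose T := {A : set nat | infinitely_often A}.
pose vals (A : T) := [set r C | C in [set C | infinitely_often C /\ C `<=` sval A]].
have vals_inf A : has_inf (vals A).
  split; first by exists (r (sval A)); exists (sval A) => //; split=> //; exact: svalP.
  by exists m => _ [C [iC _] <-]; exact: mr.
have /choice[next nextP] : forall kA : nat * T, exists A' : T,
    sval A' `<=` sval kA.2 /\ r (sval A') < inf (vals kA.2) + kA.1.+1%:R^-1.
  move=> [k A].
  have [|_ [C [iC CA] <-] rC] := @inf_adherent _ (vals A) k.+1%:R^-1 _ (vals_inf A).
    by rewrite invr_gt0.
  by exists (exist _ C iC).
pose chain := fix chain k : T :=
  if k is j.+1 then next (j, chain j) else exist _ B iB.
have [|k|A [iA AB Achain]] := @pseudo_intersection (fun k => sval (chain k)).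
- by move=> k; exact: svalP.
- by have [] := nextP (k, chain k).
exists A; split => // C iC CA; apply/ler_addgt0Pr => e e0.
have [k] : exists k, k.+1%:R^-1 < e.
  have [k _ /(_ k (leqnn k))] := near_infty_natSinv_lt (PosNum e0).
  by exists k.
move=> ke; have [_ rk] := nextP (k, chain k).
have Ck j : \forall n \near \oo, C n -> sval (chain j) n.
  by apply: filterS (Achain j) => n h /CA.
(* [C] is only almost contained in [chain k]; intersecting the two makes it a competitor for the
   infimum at stage [k] without increasing [r]. *)
have rC : inf (vals (chain k)) <= r C.
  apply: (@le_trans _ _ (r (C `&` sval (chain k)))).
    apply: ge_inf; first exact: (vals_inf _).2.
    exists (C `&` sval (chain k)) => //; split; last exact: subIsetr.
    by apply: (infinitely_often_sub iC); apply: filterS (Ck k) => n h Cn; split=> //; exact: h.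
  apply: monor; last by apply: nearW => n [].
  by apply: (infinitely_often_sub iC); apply: filterS (Ck k) => n h Cn; split=> //; exact: h.
have rA : r A <= r (sval (chain k.+1)) by apply: monor.
by rewrite (le_trans rA)// (le_trans (ltW rk))// lerD// ltW.
Qed.

(** * Nested minimization in metric spaces *)

Section MetricSpace.
Context {R : realType} {H : metricType R}.
Implicit Types (u v y : nat -> H) (A B C : set nat).

Lemma metric_cvgP u (z : H) : u n @[n --> \oo] --> z <->
  forall e : R, 0 < e -> \forall n \near \oo, mdist z (u n) < e.
Proof. exact: metricType_numDomainType.cvgrPdist_lt. Qed.

Lemma near_ge_bounded u (p : H) (M : R) :
  (\forall n \near \oo, mdist p (u n) <= M) -> bounded_seq u.
Proof.
move=> [N _ NM]; exists p, (`|M| + \sum_(i < N) mdist p (u i)) => n.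
have s0 : 0 <= \sum_(i < N) mdist p (u i) by apply: sumr_ge0 => i _; exact: mdist_ge0.
have [Nn|nN] := leqP N n.
  by rewrite (le_trans (NM n Nn))// (le_trans (ler_norm _))// lerDl.
rewrite (bigD1 (Ordinal nN))//= addrCA lerDl addr_ge0//.
by apply: sumr_ge0 => i _; exact: mdist_ge0.
Qed.

Lemma bounded_seq_at u (p : H) : bounded_seq u ->
  exists2 M : R, 0 <= M & forall n, mdist p (u n) <= M.
Proof.
move=> [q [M uM]]; exists (mdist p q + M) => [|n].
  by rewrite addr_ge0 ?mdist_ge0// (le_trans _ (uM 0%N)) ?mdist_ge0.
by rewrite (le_trans (metric_triangle _ q _))// lerD2l.
Qed.

Lemma cvg_bounded_seq {u} {z : H} : u n @[n --> \oo] --> z -> bounded_seq u.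
Proof.
move=> /metric_cvgP/(_ 1 ltr01) uz.
by apply: (@near_ge_bounded _ z 1); apply: filterS uz => n /ltW.
Qed.

(** Expand [(e + s) ^+ 2] with [s] the distance from [q] to [x]: [2 * s <= s ^+ 2 + 1] and [e <= 1]
    bound the error by a multiple of [e] that depends on [c] alone. *)
Lemma sq_mdist_le (p q x : H) (e c : R) : 0 <= e <= 1 -> mdist p q <= e ->
  mdist q x ^+ 2 <= c -> mdist p x ^+ 2 <= c + e * (c + 2).
Proof.
move=> /andP[e0 e1] pq qx; have := metric_triangle p q x.
have := mdist_ge0 q x; have := mdist_ge0 p x; have := mdist_ge0 p q.
move: (mdist p x) (mdist p q) (mdist q x) pq qx => a b s be sc b0 a0 s0 abs.
have h1 : a ^+ 2 <= (e + s) ^+ 2 by rewrite ler_pXn2r ?nnegrE ?addr_ge0//; lra.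
have h2 : e * (2 * s + e) <= e * (c + 2) 
  by rewrite ler_wpM2l//; have := sqr_ge0 (s - 1); nra.
by rewrite (le_trans h1)//; nra.
Qed.

Lemma sq_mdist_lower (p q : H) (e : R) : 0 < e ->
  exists2 d : R, 0 < d & forall q', mdist q q' < d ->
  mdist p q ^+ 2 - e <= mdist p q' ^+ 2.
Proof.
move=> e0; have D0 := mdist_ge0 p q.
have g0 : 0 < 2 * mdist p q + 1 by lra.
(* The loss is at most twice the product of the two distances; adding 1 keeps the denominator
   positive when [p = q]. *)
exists (e / (2 * mdist p q + 1)); first by rewrite divr_gt0.
move=> q' qq'; rewrite ltr_pdivlMr// in qq'.
have := metric_triangle p q' q; rewrite (metric_sym q' q).
have := mdist_ge0 q q'; have := mdist_ge0 p q'.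
move: D0 qq'; move: (mdist p q) (mdist p q') (mdist q q') => a b s a0 se b0 s0 abs.
have [as_|/ltW sa] := leP a s; first by nra.
have h : (a - s) ^+ 2 <= b ^+ 2 by rewrite ler_pXn2r ?nnegrE//; lra.
by nra.
Qed.

(* [S a] plays the role of the sublevel set at level [a] of a strongly convex
   lower semicontinuous function, and [c0] that of its minimum. *)
Lemma minimize_nested (S : R -> set H) (k m : R) : complete_metric H -> 0 < k ->
  (forall a b, a <= b -> S a `<=` S b) -> (forall a, closed (S a)) ->
  (forall a p q, S a p -> S a q -> exists z, S (a - k * mdist p q ^+ 2) z) ->
  (forall a p, S a p -> m <= a) -> (exists a p, S a p) ->
  exists z c0, (forall c, c0 < c -> S c z) /\ (forall c p, S c p -> c0 <= c).
Proof.
move=> cH k0 monoS closedS midS lbS [a0 [p0 Sp0]].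
pose E := [set a | S a !=set0].
have infE : has_inf E.
  by split; [exists a0, p0|exists m => a [p]; exact: lbS].
have geE c p : S c p -> inf E <= c by move=> Sp; apply: (ge_inf infE.2); exists p.
have /choice[u uP] n : exists p, S (inf E + n.+1%:R^-1) p.
  have [|a [p Sp] aE] := @inf_adherent _ E n.+1%:R^-1 _ infE; first by rewrite invr_gt0.
  by exists p; apply: monoS Sp; exact: ltW.
have Su n j : (n <= j)%N -> S (inf E + n.+1%:R^-1) (u j).
  by move=> nj; apply: monoS (uP j); rewrite lerD2l lef_pV2 ?posrE// ler_nat.
have [|z uz] := cH u.
  apply: cauchy_exP => e e0.
  have ke0 : 0 < k * e ^+ 2 by rewrite mulr_gt0// exprn_gt0.
  have [n _ /(_ n (leqnn n)) /= nke] := near_infty_natSinv_lt (PosNum ke0).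
  exists (u n), n => // j /= nj; rewrite ballEmdist /= ltNge; apply/negP => ed.
  (* Two almost optimal points at distance at least [e] would yield a point below the infimum of the
     levels. *)
  have [q /geE] := midS _ _ _ (Su _ _ (leqnn n)) (Su _ _ nj).
  rewrite -addrA lerDl subr_ge0 => /le_lt_trans/(_ nke).
  rewrite ltr_pM2l// ltr_pXn2r ?nnegrE ?mdist_ge0 ?(ltW e0)//.
  by rewrite ltNge ed.
exists z, (inf E); split=> // c Ec.
apply: (@closed_cvg _ _ \oo _ u (S c)) uz => //.
have cE : 0 < c - inf E by rewrite subr_gt0.
have := near_infty_natSinv_lt (PosNum cE); apply: filterS => n /= nc.
by apply: monoS (uP n); rewrite addrC -lerBrDr ltW.
Qed.

End MetricSpace.

(** * Weak compactness and asymptotic centers *)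

Section LimSup.
Context {R : realType}.

(** A limit superior is the infimum of the eventual upper bounds, so it suffices to transfer real
    bounds from [b] to [a], up to arbitrarily small slack. *)
Lemma le_limn_esup (a b : nat -> R) :
  (forall c e, 0 < e -> (\forall n \near \oo, b n <= c) ->
     \forall n \near \oo, a n <= c + e) ->
  (limn_esup (EFin \o a) <= limn_esup (EFin \o b))%E.
Proof.
move=> ab; apply: le_ereal_inf_tmp => _ [V Voo <-].
have bV n : V n -> ((b n)%:E <= ereal_sup [set (EFin \o b) x | x in V])%E.
  by move=> Vn; apply: ereal_sup_ubound; exists n.
move: bV; case: ereal_sup => [c| |] bV; last 2 first.
- exact: leey.
- by have [N _ /(_ N (leqnn N))/bV] := Voo; rewrite leeNy_eq.
apply/lee_addgt0Pr => e e0; have bc : \forall n \near \oo, b n <= c.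
  by apply: filterS Voo => n /bV; rewrite lee_fin.
apply: ge_ereal_inf; exists (ereal_sup [set (a n)%:E | n in [set n | a n <= c + e]]).
  by exists [set n | a n <= c + e] => //; exact: ab bc.
by apply: ge_ereal_sup => _ [n /= anc <-]; rewrite -EFinD lee_fin.
Qed.

Lemma lt_limn_einf (a : nat -> \bar R) (c : R) :
  (c%:E < limn_einf a)%E -> \forall n \near \oo, (c%:E < a n)%E.
Proof.
rewrite /limn_einf lteNr => /ereal_inf_lt[_ [V Voo <-]] h.
apply: filterS Voo => n Vn; rewrite -lteN2; apply: le_lt_trans h.
by apply: ereal_sup_ubound; exists n.
Qed.

End LimSup.

Section WeakCompactness.
Context {R : realType} {H : metricType R}.
Hypothesis hH : hadamard_space H.
Implicit Types (u v y : nat -> H) (A B C : set nat).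

(** One and the same point serves the distance inequality and the convexity of every [f], so that
    the two can be added. *)
Lemma hadamard_point (p q : H) (t : R) : 0 <= t <= 1 ->
  exists z, [/\ mdist p z = t * mdist p q,
    forall x, mdist x z ^+ 2 <=
      (1 - t) * mdist x p ^+ 2 + t * mdist x q ^+ 2 - t * (1 - t) * mdist p q ^+ 2 &
    forall (f : H -> \bar R) (a b : R), convex_fun f ->
      (f p <= a%:E)%E -> (f q <= b%:E)%E -> (f z <= ((1 - t) * a + t * b)%:E)%E].
Proof.
move=> /[dup] t01 /andP[t0 t1]; have [_ geoH catH] := hH.
have [g [gg g0 g1]] := geoH p q; exists (g t); split.
- by rewrite -g0 gg ?lexx ?ler01// sub0r normrN ger0_norm// g0 g1.
- by move=> x; rewrite -g0 -g1; exact: catH.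
- move=> f a b cf fa fb; have := cf g gg 0 1 t.
  rewrite !lexx !ler01 => /(_ isT isT t01).
  rewrite mulr0 add0r mulr1 g0 g1 => /le_trans; apply.
  by rewrite (EFinD (_ * _)) !EFinM leeD// lee_wpmul2l// lee_fin// subr_ge0.
Qed.

(* [rho] is the squared asymptotic radius of every subsequence of [u] along [A],
   and [z] an asymptotic center of each of them. *)
Definition regular_center u A (z : H) (rho : R) : Prop :=
  [/\ infinitely_often A,
    forall e, 0 < e -> \forall n \near \oo, A n -> mdist z (u n) ^+ 2 <= rho + e &
    forall C x c, infinitely_often C -> C `<=` A ->
      (\forall n \near \oo, C n -> mdist x (u n) ^+ 2 <= c) -> rho <= c].

Lemma bounded_regular_center u B : bounded_seq u -> infinitely_often B ->
  exists A z rho, A `<=` B /\ regular_center u A z rho.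
Proof.
move=> [p [M uM]] iB.
(* The infimum of [E A] is the squared asymptotic radius of [u] along [A]. *)
pose E A := [set c | exists x, \forall n \near \oo, A n -> mdist x (u n) ^+ 2 <= c].
have lbE A : infinitely_often A -> lbound (E A) 0.
  move=> iA c [x xc]; have [n An /(_ An)] := infinitely_often_near iA xc.
  by apply: le_trans; exact: sqr_ge0.
have E0 A : E A !=set0.
  exists (M ^+ 2), p; apply: nearW => n _.
  by rewrite ler_pXn2r ?nnegrE ?mdist_ge0// (le_trans _ (uM n)) ?mdist_ge0.
have [|A C iA AC|A [iA AB minA]] :=
    @minimal_infinitely_often _ (inf \o E) 0 _ iB.
- by move=> A iA; apply: lb_le_inf => //; exact: lbE.
- apply: lb_le_inf => // c [x xc]; apply: ge_inf; first by exists 0; exact: lbE.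
  by exists x; apply: filterS2 AC xc => n h1 h2 /h1.
have centerA C x c : infinitely_often C -> C `<=` A ->
    (\forall n \near \oo, C n -> mdist x (u n) ^+ 2 <= c) -> inf (E A) <= c.
  move=> iC CA xc; apply: le_trans (minA C iC CA) _.
  by apply: ge_inf; [exists 0; exact: lbE|exists x].
(* Sublevel sets of the limit superior of the squared distances along [A]; the slack [e] makes them
   closed. *)
pose S c := [set x | forall e, 0 < e ->
  \forall n \near \oo, A n -> mdist x (u n) ^+ 2 <= c + e].
(* The constant [4^-1] is [t * (1 - t)] at the midpoint [t = 2^-1]. *)
have [|||||||z [c0 [Sz c0S]]] := @minimize_nested R H S 4^-1 0.
- by case: hH.
- by rewrite invr_gt0.
- move=> a b ab x Sx e e0; apply: filterS (Sx e e0) => n h /h /le_trans; apply.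
  by rewrite lerD2r.
- move=> a x Sx e e0.
  (* With the level [a + Num.min 1 (e / 2)], the error in [sq_mdist_le] is at most
     [d * (|a| + 4) <= e / 2]. *)
  pose d := Num.min 1 (e / 2 / (`|a| + 4)).
  have a4 : 0 < `|a| + 4 by rewrite ltr_wpDl.
  have d0 : 0 < d by rewrite lt_min ltr01 divr_gt0// divr_gt0.
  have [y [Sy]] := Sx _ (nbhsx_ballx x d d0).
  rewrite ballEmdist /= => xy.
  have e20 : 0 < Num.min 1 (e / 2) by rewrite lt_min ltr01 divr_gt0.
  apply: filterS (Sy _ e20) => k h /h yk.
  have d1 : 0 <= d <= 1 by rewrite ltW//= ge_min lexx.
  apply: (le_trans (sq_mdist_le d1 (ltW xy) yk)).
  have w1 : Num.min 1 (e / 2) <= 1 by rewrite ge_min lexx.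
  have w2 : Num.min 1 (e / 2) <= e / 2 by rewrite ge_min lexx orbT.
  have de : d * (`|a| + 4) <= e / 2 by rewrite -ler_pdivlMr// ge_min lexx orbT.
  have : d * (a + Num.min 1 (e / 2) + 2) <= d * (`|a| + 4).
    by rewrite ler_wpM2l ?(ltW d0)//; have := ler_norm a; lra.
  lra.
- move=> a x y Sx Sy.
  have [|z [_ catz _]] := @hadamard_point x y 2^-1; first by lra.
  exists z => e e0; apply: filterS2 (Sx e e0) (Sy e e0) => n hx hy An.
  have := catz (u n); rewrite !(metric_sym (u n)).
  by have := hx An; have := hy An; lra.
- move=> a x Sx; apply/ler_addgt0Pr => e e0.
  by apply: lbE iA _ _; exists x; exact: Sx.
- exists (M ^+ 2), p => e e0; apply: nearW => n _.
  rewrite ler_wpDr ?(ltW e0)// ler_pXn2r ?nnegrE ?mdist_ge0//.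
  by rewrite (le_trans _ (uM n)) ?mdist_ge0.
have c0E : c0 <= inf (E A).
  apply: lb_le_inf => // c [x xc]; apply: (c0S c x) => e e0.
  by apply: filterS xc => n h /h /le_trans; apply; rewrite lerDl ltW.
exists A, z, (inf (E A)); split=> //; split=> // e e0.
have e20 : 0 < e / 2 by rewrite divr_gt0.
have : c0 < inf (E A) + e / 2 by lra.
move=> /Sz/(_ _ e20); apply: filterS => n h /h /le_trans; apply.
by lra.
Qed.

(** Weak lower semicontinuity of the squared distance. If it failed on an infinite subset of [A],
    moving from [z] slightly towards [x] would bring the radius of that subset below [rho]. *)
Lemma regular_center_lsc u A z rho (x : H) (e : R) : regular_center u A z rho ->
  0 < e -> \forall n \near \oo, A n -> mdist x z ^+ 2 - e <= mdist x (u n) ^+ 2.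
Proof.
move=> [iA upz lowz] e0; apply: contrapT => /not_near_infinitely_often iC.
set D := mdist x z ^+ 2 in iC *; have D0 : 0 <= D by exact: sqr_ge0.
pose C := ~` [set n | A n -> D - e <= mdist x (u n) ^+ 2].
have CA : C `<=` A by move=> n /not_implyP[].
have Cx n : C n -> mdist x (u n) ^+ 2 <= D - e.
  by move=> /not_implyP[_ /negP]; rewrite -ltNge => /ltW.
have rho0 : 0 <= rho.
  rewrite leNgt; apply/negP => rho0; have r20 : 0 < - rho / 2 by rewrite divr_gt0 ?oppr_gt0.
  have [n An /(_ An)] := infinitely_often_near iA (upz _ r20).
  by have := sqr_ge0 (mdist z (u n)); lra.
(* This choice gives [t * D - e = - (t * e)], a gain of [t ^+ 2 * e] in the inequality at [m], of
   which the slack in [upz] uses at most half. What remains is [t * rho < 0]. *)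
pose t := e / (D + e); have De : 0 < D + e by rewrite ltr_wpDl.
have tDe : t * (D + e) = e by rewrite /t divfK// gt_eqF.
have t0 : 0 < t by rewrite divr_gt0.
have t1 : t <= 1 by rewrite ler_pdivrMr// mul1r lerDr.
have [|m [_ catm _]] := @hadamard_point z x t; first by rewrite (ltW t0).
have te0 : 0 < t ^+ 2 * e / 2 by rewrite divr_gt0// mulr_gt0// exprn_gt0.
suff : rho <= (1 - t) * (rho + t ^+ 2 * e / 2) + t * (D - e) - t * (1 - t) * D by nra.
apply: (lowz C m) => //; apply: filterS (upz _ te0) => n h Cn.
rewrite metric_sym (le_trans (catm (u n)))// (metric_sym z x) -/D.
rewrite lerD2r lerD// ler_wpM2l ?subr_ge0 ?(ltW t0) ?(metric_sym (u n))//.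
- exact: h (CA _ Cn).
- exact: Cx.
Qed.

(* Mosco's condition (M1) concerns full sequences, so a subsequence has to be
   completed by a sequence [y] converging to the same limit. *)
Lemma regular_center_weak_cvg u y A z rho : bounded_seq u ->
  regular_center u A z rho -> y n @[n --> \oo] --> z ->
  weak_cvg (fun n => if n \in A then u n else y n) z.
Proof.
move=> bu [iA upz lowz] yz; set w := fun n => _.
have bw : bounded_seq w.
  have [M M0 uM] := bounded_seq_at z bu.
  have [M' M'0 yM] := bounded_seq_at z (cvg_bounded_seq yz).
  exists z, (M + M') => n; rewrite /w; case: ifP => _.
    by rewrite (le_trans (uM n))// lerDl.
  by rewrite (le_trans (yM n))// lerDr.
split=> // phi hphi x /=.
have phi_near (P : set nat) : (\forall n \near \oo, P n) -> \forall n \near \oo, P (phi n).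
  move=> [N _ NP]; exists N => // n /= Nn; apply: NP => /=.
  exact: leq_trans Nn (increasing_geq hphi n).
apply: (@le_limn_esup _ (fun n => mdist z (w (phi n)) ^+ 2)
  (fun n => mdist x (w (phi n)) ^+ 2)) => c e e0 xc.
have c0 : 0 <= c by have [n _ /(_ n (leqnn n))] := xc; apply: le_trans; exact: sqr_ge0.
have yze : \forall n \near \oo, mdist z (y n) ^+ 2 <= e.
  have e10 : 0 < Num.min 1 e by rewrite lt_min ltr01.
  have /metric_cvgP/(_ _ e10) := yz; apply: filterS => n.
  rewrite lt_min => /andP[d1 de]; have := mdist_ge0 z (y n).
  by move: d1 de; move: (mdist z (y n)) => d; nra.
(* If the subsequence meets [A] infinitely often, regularity forces [rho <= c]; otherwise it
   eventually follows [y], whose distance to [z] vanishes. *)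
have [iS|nS] := pselect (infinitely_often [set n | A (phi n)]).
- have rc : rho <= c.
    apply: (lowz (A `&` range phi) x) => [N||].
    + have [n Nn An] := iS N; exists (phi n); last by split=> //; exists n.
      exact: leq_trans Nn (increasing_geq hphi n).
    + exact: subIsetl.
    + have [N _ NP] := xc; exists (phi N) => // _ /= /[swap] -[/[swap] -[n _ <-] An] Nn.
      have Nn' : (N <= n)%N.
        by rewrite leqNgt; apply/negP => /hphi; rewrite ltnNge Nn.
      by have := NP n Nn'; rewrite /= /w mem_set.
  near=> n; rewrite /w; case: ifPn => [/set_mem An|_].
    suff : mdist z (u (phi n)) ^+ 2 <= rho + e by move=> /le_trans; apply; rewrite lerD2r.
    by move: An; near: n; apply: phi_near (upz e e0).
  suff : mdist z (y (phi n)) ^+ 2 <= e by move=> /le_trans; apply; rewrite lerDr.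
  by near: n; exact: phi_near yze.
- have nA : \forall n \near \oo, ~ A (phi n).
    apply: contrapT => /not_near_infinitely_often iS; apply: nS.
    by apply: infinitely_often_sub iS _; apply: nearW => n /contrapT.
  near=> n; rewrite /w memNset; last by near: n.
  suff : mdist z (y (phi n)) ^+ 2 <= e by move=> /le_trans; apply; rewrite lerDr.
  by near: n; exact: phi_near yze.
Unshelve. all: by end_near. Qed.

End WeakCompactness.

(** * Moreau-Yosida objectives *)

Section Moreau.
Context {R : realType} {H : metricType R}.
Hypothesis hH : hadamard_space H.
Implicit Types (f g : H -> \bar R) (u v y : nat -> H) (A B C : set nat).

(** A convergent sequence is regular of radius 0 along all indices, and completing it by itself
    changes nothing. *)
Lemma cvg_weak_cvg u (z : H) : u n @[n --> \oo] --> z -> weak_cvg u z.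
Proof.
move=> uz.
have : regular_center u setT z 0.
  split=> [N|e e0|C x c iC _ xc]; first by exists N.
  - have /metric_cvgP/(_ (Num.min 1 e)) := uz; rewrite lt_min ltr01 => /(_ e0).
    apply: filterS => n; rewrite lt_min add0r => /andP[d1 de] _.
    by have := mdist_ge0 z (u n); move: d1 de; move: (mdist z (u n)) => d; nra.
  - have [n Cn /(_ Cn)] := infinitely_often_near iC xc.
    by apply: le_trans; exact: sqr_ge0.
move=> /(regular_center_weak_cvg (cvg_bounded_seq uz))/(_ uz).
by under eq_fun do rewrite in_setT.
Qed.

(** Otherwise, points ever closer to [z] with values tending to [-oo] exist along increasing indices
    [phi k]. Filled up with [z] at the other indices, they form a sequence converging to [z] that
    contradicts the liminf inequality. *)
Lemma weak_liminf_lower_bound (fn : nat -> H -> \bar R) (l : \bar R) (z : H) :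
  l != -oo%E ->
  (forall u, weak_cvg u z -> (l <= limn_einf (fun n => fn n (u n)))%E) ->
  exists2 K : R, 0 < K & \forall n \near \oo,
    forall p, mdist z p < K^-1 -> ((- K)%:E <= fn n p)%E.
Proof.
move=> lNy M1; apply: contrapT => nK.
pose Q k n p := mdist z p < k.+1%:R^-1 /\ (fn n p < (- k.+1%:R)%:E)%E.
have [k|phi hphi Qphi] := @increasing_selection (fun k => [set n | exists p, Q k n p]).
  apply: (@infinitely_often_sub (~` [set n | forall p, mdist z p < k.+1%:R^-1 ->
      ((- k.+1%:R)%:E <= fn n p)%E])).
    apply: not_near_infinitely_often => h; apply: nK.
    by exists k.+1%:R.
  apply: nearW => n /= /existsNP[p /not_implyP[zp /negP]].
  by rewrite -ltNge => fp; exists p.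
have phi_inj : injective phi.
  by move=> i j ij; case: (ltngtP i j) => // /hphi; rewrite ij ltnn.
have /choice[u uP] n : exists p, (forall k, phi k = n -> Q k n p) /\
    ((forall k, phi k <> n) -> p = z).
  have [[k kn]|nk] := pselect (exists k, phi k = n).
    have [p Qp] := Qphi k; exists p; split=> [j jn|/(_ k)//].
    by have -> : j = k by [apply: phi_inj; rewrite jn]; rewrite -kn.
  by exists z; split=> // k kn; exfalso; apply: nk; exists k.
have uz : u n @[n --> \oo] --> z.
  apply/metric_cvgP => e e0.
  have [k _ ke] := near_infty_natSinv_lt (PosNum e0).
  exists (phi k) => // n /= kn; have [[j jn]|nj] := pselect (exists j, phi j = n).
    have [/(_ j jn)[zu _] _] := uP n; rewrite (lt_trans zu)//; apply: ke => /=.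
    by rewrite leqNgt; apply/negP => /hphi; rewrite jn ltnNge kn.
  have [_ ->] := uP n; first by rewrite mdistxx.
  by move=> j jn; apply: nj; exists j.
have [c cl] : exists c : R, (c%:E < l)%E.
  case: l lNy {M1} => [r| |]// _; first by exists (r - 1); rewrite lte_fin; lra.
  by exists 0; exact: ltry.
have [N _ NP] := lt_limn_einf (lt_le_trans cl (M1 u (cvg_weak_cvg uz))).
have [k Nk ck] : exists2 k, (N <= k)%N & - k.+1%:R <= c.
  have [k _ kc] := nbhs_infty_ger (- c).
  exists (maxn N k); first exact: leq_maxl.
  rewrite lerNl (le_trans (kc k _))//= ler_nat.
  by rewrite (leq_trans (leq_maxr N k)).
have /= := NP (phi k) (leq_trans Nk (increasing_geq hphi k)).
have [/(_ k erefl)[_ fk] _] := uP (phi k).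
move=> /lt_trans/(_ fk); rewrite lte_fin.
by rewrite ltNge ck.
Qed.

(** A value too low at a distant [p] would, by convexity on the geodesic from [y n] to [p], produce
    a value below [- K] close to [z]. *)
Lemma convex_linear_lower_bound (fn : nat -> H -> \bar R) y (z : H) (c K : R) :
  (forall n, convex_fun (fn n)) -> y n @[n --> \oo] --> z ->
  (\forall n \near \oo, (fn n (y n) <= c%:E)%E) -> 0 < K ->
  (\forall n \near \oo, forall p, mdist z p < K^-1 -> ((- K)%:E <= fn n p)%E) ->
  exists L : R, \forall n \near \oo, forall p,
    ((- (L * (1 + mdist z p)))%:E <= fn n p)%E.
Proof.
move=> cfn yz fyc K0 lbK; pose e := Num.min 1 K^-1.
have e0 : 0 < e by rewrite lt_min ltr01 invr_gt0.
have e1 : e <= 1 by rewrite ge_min lexx.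
have eK : e <= K^-1 by rewrite ge_min lexx orbT.
have e40 : 0 < e / 4 by rewrite divr_gt0.
(* Chosen so that, for the [t] below, [t * (L * (1 + D)) = |c| + K + 1], which brings the value at
   [q] down to [- K - 1] or less. *)
pose L := 2 * (`|c| + K + 1) / e; exists L.
have /metric_cvgP/(_ _ e40) yze := yz.
apply: filterS3 yze fyc lbK => n zy fy lb p; rewrite leNgt; apply/negP => fp.
set D := mdist z p in fp; have D0 : 0 <= D by exact: mdist_ge0.
have D1 : 0 < 2 * (1 + D) by rewrite mulr_gt0// ltr_wpDr.
(* The point [q] is then within [e / 2] of [y n], hence within [3 * e / 4] of [z]. *)
pose t := e / (2 * (1 + D)).
have tE : t * (2 * (1 + D)) = e by rewrite /t divfK// gt_eqF.
have t0 : 0 < t by rewrite divr_gt0.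
have t1 : t <= 1 by rewrite ler_pdivrMr// mul1r; lra.
have [|q [yq _ cq]] := @hadamard_point _ _ hH (y n) p t; first by rewrite ltW.
have zq : mdist z q < K^-1.
  apply: lt_le_trans eK; apply: le_lt_trans (metric_triangle _ (y n) _) _.
  rewrite yq; have : t * mdist (y n) p <= t * (1 + D).
    rewrite ler_wpM2l ?(ltW t0)// (le_trans (metric_triangle _ z _))//.
    by rewrite lerD2r metric_sym; lra.
  by lra.
have := le_trans (lb q zq) (cq _ _ _ (cfn n) fy (ltW fp)); rewrite lee_fin.
have -> : t * - (L * (1 + D)) = - (`|c| + K + 1).
  have LE : L * e = 2 * (`|c| + K + 1) by rewrite /L divfK// gt_eqF.
  by move: LE; rewrite -tE; lra.
have : (1 - t) * c <= `|c|.
  rewrite (le_trans (ler_norm _))// normrM ler_piMl// ger0_norm; lra.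
lra.
Qed.

Lemma moreau_objective_le f (l : R) (x p : H) (a : R) :
  (moreau_objective f l x p <= a%:E)%E =
  (f p <= (a - (2 * l)^-1 * mdist x p ^+ 2)%:E)%E.
Proof. by rewrite EFinB leeBrDr. Qed.

Lemma moreau_objective_ge f (l : R) (x p : H) (a : R) :
  (a%:E <= moreau_objective f l x p)%E =
  ((a - (2 * l)^-1 * mdist x p ^+ 2)%:E <= f p)%E.
Proof. by rewrite EFinB leeBlDr. Qed.

(** Strong convexity of the objective: the midpoint gains [4^-1] of the squared distance, weighted
    by [(2 * l)^-1]. *)
Lemma moreau_objective_midpoint f (l : R) (x p q : H) (a : R) : 0 < l ->
  convex_fun f -> (moreau_objective f l x p <= a%:E)%E ->
  (moreau_objective f l x q <= a%:E)%E ->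
  exists z, (moreau_objective f l x z <= (a - (8 * l)^-1 * mdist p q ^+ 2)%:E)%E.
Proof.
rewrite !moreau_objective_le => l0 cf fp fq.
have [|z [_ catz cz]] := @hadamard_point _ _ hH p q 2^-1; first by lra.
exists z; rewrite moreau_objective_le (le_trans (cz _ _ _ cf fp fq))// lee_fin.
have -> : (8 * l)^-1 = (2 * l)^-1 * 4^-1 by field; rewrite gt_eqF.
have k0 : 0 < (2 * l)^-1 by rewrite invr_gt0 mulr_gt0.
have := ler_wpM2l (ltW k0) (catz x); lra.
Qed.

(** Half of the quadratic term absorbs the linear bound by completing a square. [C] is chosen before
    [f], so it serves all [fn n] at once. *)
Lemma moreau_objective_coercive (l L : R) (x z : H) : 0 < l ->
  exists C : R, forall f p a, ((- (L * (1 + mdist z p)))%:E <= f p)%E ->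
    (moreau_objective f l x p <= a%:E)%E -> (4 * l)^-1 * mdist x p ^+ 2 <= a + C.
Proof.
move=> l0; pose L' := `|L|; pose D := mdist z x.
exists (L' * (1 + D) + l * L' ^+ 2) => f p a lb.
rewrite moreau_objective_le => /(le_trans lb); rewrite lee_fin => h.
have -> : (4 * l)^-1 = (2 * l)^-1 / 2 by field; rewrite gt_eqF.
have k0 : 0 < (2 * l)^-1 by rewrite invr_gt0 mulr_gt0.
have kE : (2 * l)^-1 * (2 * l) = 1 by rewrite mulVf// gt_eqF// mulr_gt0.
set s := mdist x p in h *; set k := (2 * l)^-1 in h k0 kE *.
have s0 : 0 <= s by exact: mdist_ge0.
have Lle : L * (1 + mdist z p) <= L' * (1 + D + s).
  apply: (@le_trans _ _ (L' * (1 + mdist z p))).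
    by rewrite ler_wpM2r ?addr_ge0 ?mdist_ge0// ler_norm.
  by rewrite ler_wpM2l ?normr_ge0// -addrA lerD2l; exact: metric_triangle.
have sq : 0 <= k / 2 * (s - 2 * l * L') ^+ 2 by rewrite mulr_ge0 ?sqr_ge0// divr_ge0// ltW.
have sqE : k / 2 * (s - 2 * l * L') ^+ 2 =
    k / 2 * s ^+ 2 - (k * (2 * l)) * (s * L') + (k * (2 * l)) * (l * L' ^+ 2) by field.
by rewrite sqE kE !mul1r in sq; lra.
Qed.

Lemma moreau_objective_attained f (l : R) (x : H) : 0 < l ->
  proper_fun f -> convex_fun f -> lower_semicontinuous f ->
  exists (z : H) (r : R), moreau_objective f l x z = r%:E /\
    argmin (moreau_objective f l x) z.
Proof.
move=> l0 [fNy [y0 fy0]] cf lscf; set g := moreau_objective f l x.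
have fy0E : f y0 = (fine (f y0))%:E by rewrite fineK// fin_numE fNy.
have [L lbL] : exists L : R, forall p, ((- (L * (1 + mdist y0 p)))%:E <= f p)%E.
  have [V y0V Vf] : exists2 V, nbhs y0 V &
      forall p, V p -> ((fine (f y0) - 1)%:E < f p)%E.
    by apply: lscf; rewrite fy0E lte_fin; lra.
  move: y0V; rewrite -nbhs_ballE => -[e /= e0]; rewrite ballEmdist => eV.
  (* Large enough for both [K^-1 <= e] and [- K <= fine (f y0) - 1]. *)
  pose K := e^-1 + `|fine (f y0) - 1|.
  have K0 : 0 < K by rewrite ltr_wpDr// invr_gt0.
  have [|||L [n _ /(_ n (leqnn n))]] := @convex_linear_lower_bound
      (fun=> f) (fun=> y0) y0 (fine (f y0)) K (fun=> cf) (cvg_cst _); last 1 first.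
  - by exists L.
  - by apply: nearW => _; rewrite -fy0E.
  - by [].
  - apply: nearW => _ p y0p; apply: (le_trans _ (ltW (Vf p _))).
      have := ler_norm (- (fine (f y0) - 1)); rewrite normrN lee_fin.
      have : 0 < e^-1 by rewrite invr_gt0.
      by rewrite /K; lra.
    apply: eV; rewrite /= (lt_le_trans y0p)//.
    by rewrite -[leRHS]invrK lef_pV2 ?posrE ?invr_gt0// lerDl.
have [C coer] := moreau_objective_coercive L x y0 l0.
have k0 : 0 < (2 * l)^-1 by rewrite invr_gt0 mulr_gt0.
have [|||||||z [c0 [zc c0le]]] :=
  @minimize_nested R H (fun a => [set p | (g p <= a%:E)%E]) (8 * l)^-1 (- C).
- by case: hH.
- by rewrite invr_gt0 mulr_gt0.
- by move=> a b ab p /= /le_trans; apply; rewrite lee_fin.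
- move=> a p clp; rewrite /= leNgt; apply/negP => ap.
  pose a' := a - (2 * l)^-1 * mdist x p ^+ 2.
  have {}ap : (a'%:E < f p)%E by rewrite ltNge -moreau_objective_le -ltNge.
  (* A level strictly between [a'] and [f p]: near [p], [f] stays above [b], while the quadratic
     term drops by at most [b - a']. *)
  have [b ab bf] : exists2 b, a' < b & (b%:E < f p)%E.
    move: ap; case: (f p) (fNy p) => [r| |]// _ ap.
      by move: ap; rewrite lte_fin => ap; exists ((a' + r) / 2); rewrite ?lte_fin; lra.
    by exists (a' + 1); [lra|exact: ltry].
  have [V pV Vf] := lscf _ _ bf.
  have e0 : 0 < (b - a') * (2 * l) by rewrite mulr_gt0 ?mulr_gt0// subr_gt0.
  have [d d0 dist_d] := sq_mdist_lower x p e0.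
  have [q [/= gq [Vq]]] := clp _ (filterI pV (nbhsx_ballx p d d0)).
  rewrite ballEmdist /= => pq; move: gq; rewrite moreau_objective_le.
  rewrite leNgt => /negP; apply; apply: le_lt_trans (Vf q Vq); rewrite lee_fin.
  have := ler_wpM2l (ltW k0) (dist_d q pq); rewrite mulrBr [_ * (_ * (2 * l))]mulrCA.
  by rewrite mulVf ?gt_eqF ?mulr_gt0// /a' mulr1; lra.
- by move=> a p q; exact: moreau_objective_midpoint.
- move=> a p /(coer f p a (lbL p)); rewrite -[_ <= a]subr_ge0 opprK; apply: le_trans.
  by rewrite mulr_ge0 ?sqr_ge0// invr_ge0 mulr_ge0// ltW.
- exists (fine (g y0)), y0 => /=; rewrite fineK// /g /moreau_objective fy0E.
  by rewrite -EFinD.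
have gz : (g z <= c0%:E)%E.
  by apply/lee_addgt0Pr => e e0; rewrite -EFinD; apply: zc; rewrite ltrDl.
have gNy p : g p != -oo%E by rewrite /g /moreau_objective adde_eq_ninfty negb_or fNy.
have gzE : g z = (fine (g z))%:E.
  by rewrite fineK// fin_numE gNy/= -ltey (le_lt_trans gz)// ltry.
exists z, (fine (g z)); split=> // p; apply: (le_trans gz).
have := c0le^~ p; rewrite /=; case: (g p) (gNy p) => [r| |]// _ h; last exact: leey.
by rewrite lee_fin; exact: h.
Qed.

End Moreau.

(** * Mosco convergence *)

Section MoscoMoreau.
Context {R : realType} {H : metricType R}.
Hypothesis hH : hadamard_space H.
Context {f : H -> \bar R} {fn : nat -> H -> \bar R}.
Hypothesis hf : [/\ proper_fun f, convex_fun f & lower_semicontinuous f].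
Hypothesis hfn : forall n,
  [/\ proper_fun (fn n), convex_fun (fn n) & lower_semicontinuous (fn n)].
Hypothesis hM : mosco_cvg fn f.
Context {l : R} (x : H).
Hypothesis l0 : 0 < l.

(** Since the minimum is attained, [xget] never falls back on its default, and the envelope is a
    real number. *)
Lemma envelope_resolvent (g : H -> \bar R) :
  [/\ proper_fun g, convex_fun g & lower_semicontinuous g] ->
  exists r : R, [/\ moreau_envelope g l x = r%:E,
    moreau_objective g l x (resolvent g l x) = r%:E &
    forall p, (r%:E <= moreau_objective g l x p)%E].
Proof.
move=> [pg cg lg].
have [z [r [gz zmin]]] := moreau_objective_attained hH x l0 pg cg lg.
have Jmin : argmin (moreau_objective g l x) (resolvent g l x).
  by apply: xgetPex; exists z.
have gJ : moreau_objective g l x (resolvent g l x) = r%:E.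
  by apply/eqP; rewrite eq_le -gz Jmin zmin.
exists r; split=> // [|p]; last by rewrite -gz; exact: zmin.
apply/eqP; rewrite eq_le; apply/andP; split.
  by apply: ereal_inf_lbound; exists z.
by apply: le_ereal_inf_tmp => _ [p _ <-]; rewrite -gz; exact: zmin.
Qed.

Lemma recovery_objective (z : H) (r e : R) (y : nat -> H) :
  moreau_objective f l x z = r%:E -> y n @[n --> \oo] --> z ->
  fn n (y n) @[n --> \oo] --> f z -> 0 < e ->
  \forall n \near \oo, (moreau_objective (fn n) l x (y n) <= (r + e)%:E)%E.
Proof.
move=> gz yz fyz e0; have k0 : 0 < (2 * l)^-1 by rewrite invr_gt0 mulr_gt0.
have fzE : f z = (r - (2 * l)^-1 * mdist x z ^+ 2)%:E.
  by rewrite EFinB -gz addeK.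
move: fyz; rewrite fzE => /fine_cvgP[fin_y].
have e20 : 0 < e / 2 by rewrite divr_gt0.
move=> /cvgrPdist_le/(_ _ e20) fy.
pose s := mdist x z ^+ 2; have s0 : 0 <= s by exact: sqr_ge0.
have s20 : 0 < s + 2 by rewrite ltr_wpDl.
(* Moving from [z] to [y n] then costs at most [e / 2] in the quadratic term; the other half of [e]
   is for the values of [fn n]. *)
pose d := Num.min 1 (e * l / (s + 2)).
have d0 : 0 < d by rewrite lt_min ltr01 divr_gt0// mulr_gt0.
have d1 : 0 <= d <= 1 by rewrite ltW//= ge_min lexx.
have ds : (2 * l)^-1 * (d * (s + 2)) <= e / 2.
  have : d * (s + 2) <= e * l by rewrite -ler_pdivlMr// ge_min lexx orbT.
  move=> /(ler_wpM2l (ltW k0))/le_trans; apply.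
  by rewrite le_eqVlt; apply/orP; left; apply/eqP; field; rewrite gt_eqF.
have /metric_cvgP/(_ _ d0) yd := yz.
apply: filterS3 fin_y fy yd => n /fineK fnyE /= fy yd.
rewrite moreau_objective_le -fnyE lee_fin.
have zs : mdist z x ^+ 2 <= s by rewrite metric_sym.
have yz_d : mdist (y n) z <= d by rewrite metric_sym ltW.
have := sq_mdist_le d1 yz_d zs; rewrite (metric_sym _ x) => /(ler_wpM2l (ltW k0)).
rewrite -/s in fy *.
move: fy; rewrite ler_distlC => /andP[_ fy].
by move: ds fy; rewrite !mulrDr; lra.
Qed.

(** At a point where [f] is finite, (M1) gives a local lower bound and (M2) nearby points with
    bounded values; convexity does the rest. *)
Lemma mosco_linear_lower_bound : exists (z : H) (L : R), \forall n \near \oo,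
  forall p, ((- (L * (1 + mdist z p)))%:E <= fn n p)%E.
Proof.
have [[fNy [z fz]] _ _] := hf; exists z.
have fzE : f z = (fine (f z))%:E by rewrite fineK// fin_numE fNy.
have [M1 [y [yz fyz]]] := hM z.
have [K K0 lbK] := weak_liminf_lower_bound (fNy z) M1.
apply: (@convex_linear_lower_bound _ _ hH fn y z (fine (f z) + 1) K) => //.
  by move=> n; have [] := hfn n.
move: fyz; rewrite fzE => /fine_cvgP[fin_y /cvgrPdist_le/(_ _ ltr01)].
apply: filterS2 fin_y => n /fineK fnyE /=.
by rewrite ler_distlC -fnyE lee_fin => /andP[_].
Qed.

(* A sequence violating the bound would be bounded by coercivity; on a regular
   subsequence with weak limit [z], (M1) and weak lower semicontinuity of the
   distance bound the objectives from below by the objective of [f] at [z]. *)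
Lemma moreau_objective_near_ge (r e : R) :
  (forall p, (r%:E <= moreau_objective f l x p)%E) -> 0 < e ->
  \forall n \near \oo, forall p, ((r - e)%:E <= moreau_objective (fn n) l x p)%E.
Proof.
move=> rmin e0; apply: contrapT => /not_near_infinitely_often.
set B := ~` _ => iB; have k0 : 0 < (2 * l)^-1 by rewrite invr_gt0 mulr_gt0.
have /choice[u uP] n : exists p,
    B n -> (moreau_objective (fn n) l x p <= (r - e)%:E)%E.
  have [Bn|nB] := pselect (B n); last by exists x.
  by have /existsNP[p /negP] := Bn; rewrite -ltNge => /ltW; exists p.
have [z0 [L lbL]] := mosco_linear_lower_bound.
have [C coer] := moreau_objective_coercive L x z0 l0.
pose v n := if n \in B then u n else x.
have bv : bounded_seq v.
  apply: (@near_ge_bounded _ _ _ x (`|4 * l * (r - e + C)| + 1)).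
  apply: filterS lbL => n lb; rewrite /v; case: ifPn => [/set_mem Bn|_]; last first.
    by rewrite mdistxx addr_ge0.
  have := coer (fn n) (u n) _ (lb _) (uP n Bn).
  rewrite ler_pdivrMl ?mulr_gt0// => /le_trans/(_ (ler_norm _)).
  have := mdist_ge0 x (u n); move: (mdist x (u n)) => s.
  by have := normr_ge0 (4 * l * (r - e + C)); nra.
have [A [z [rho [AB Az]]]] := bounded_regular_center hH bv iB.
have [M1 [y [yz _]]] := hM z.
(* Half of [e] is spent on the values of [f], the other half on the squared distance, where a loss
   of [e * l] costs [e / 2]. *)
have fz : ((r - e / 2 - (2 * l)^-1 * mdist x z ^+ 2)%:E < f z)%E.
  have := rmin z; rewrite moreau_objective_ge; apply: lt_le_trans.
  by rewrite lte_fin; lra.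
have near_f := lt_limn_einf (lt_le_trans fz (M1 _ (regular_center_weak_cvg bv Az yz))).
have el0 : 0 < e * l by rewrite mulr_gt0.
have near_d := regular_center_lsc hH x Az el0.
have [iA _ _] := Az.
have [n An [fvn /(_ An) dvn]] := infinitely_often_near iA (filterI near_f near_d).
have Bn := AB _ An; have := uP n Bn; rewrite moreau_objective_le leNgt => /negP; apply.
move: fvn dvn; rewrite /v !mem_set// => fvn dvn.
apply: le_lt_trans fvn; rewrite lee_fin.
have := ler_wpM2l (ltW k0) dvn; rewrite mulrBr.
have -> : (2 * l)^-1 * (e * l) = e / 2 by field; rewrite gt_eqF.
lra.
Qed.

Lemma moreau_envelope_cvg :
  moreau_envelope (fn n) l x @[n --> \oo] --> moreau_envelope f l x.
Proof.
have [r [-> gJ rmin]] := envelope_resolvent hf.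
have /choice[rn rnP] n := envelope_resolvent (hfn n).
have -> : (fun n => moreau_envelope (fn n) l x) = EFin \o rn.
  by apply/funext => n; have [] := rnP n.
apply/fine_cvgP; split; first exact: nearW.
apply/cvgrPdist_le => e e0.
have [_ [y [yz fyz]]] := hM (resolvent f l x).
apply: filterS2 (recovery_objective gJ yz fyz e0) (moreau_objective_near_ge rmin e0).
move=> n up lo; have [_ gJn rnmin] := rnP n.
rewrite ler_distlC /=; apply/andP; split.
  by have := lo (resolvent (fn n) l x); rewrite gJn lee_fin.
by have := le_trans (rnmin (y n)) up; rewrite lee_fin.
Qed.

(** Both [y n] and the resolvent of [fn n] lie at level [r + e], while no value is below [r - e];
    strong convexity then bounds their squared distance by a multiple of [e]. *)
Lemma resolvent_cvg :
  resolvent (fn n) l x @[n --> \oo] --> resolvent f l x.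
Proof.
have [r [_ gJ rmin]] := envelope_resolvent hf.
have [_ [y [yz fyz]]] := hM (resolvent f l x).
apply/metric_cvgP => d d0.
have d20 : 0 < d / 2 by rewrite divr_gt0.
(* At distance [d / 2] the midpoint gains [4 * e], more than the available gap [2 * e]. *)
pose e := (d / 2) ^+ 2 / (32 * l).
have e0 : 0 < e by rewrite divr_gt0 ?exprn_gt0// mulr_gt0.
have /metric_cvgP/(_ _ d20) yd := yz.
apply: filterS3 yd (recovery_objective gJ yz fyz e0) (moreau_objective_near_ge rmin e0).
move=> n yd up lo; apply: le_lt_trans (metric_triangle _ (y n) _) _.
rewrite [ltRHS]splitr ltrD// ltNge; apply/negP => far.
have [rn [_ gJn rnmin]] := envelope_resolvent (hfn n).
have cfn : convex_fun (fn n) by have [] := hfn n.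
have upJ : (moreau_objective (fn n) l x (resolvent (fn n) l x) <= (r + e)%:E)%E.
  by rewrite gJn (le_trans (rnmin _) up).
have [z gz] := moreau_objective_midpoint hH l0 cfn up upJ.
have := le_trans (lo z) gz; rewrite lee_fin.
have k0 : 0 < (8 * l)^-1 by rewrite invr_gt0 mulr_gt0.
have : (8 * l)^-1 * (d / 2) ^+ 2 <=
    (8 * l)^-1 * mdist (y n) (resolvent (fn n) l x) ^+ 2.
  by rewrite ler_wpM2l ?(ltW k0)// ler_pXn2r ?nnegrE ?mdist_ge0// ltW.
have -> : (8 * l)^-1 * (d / 2) ^+ 2 = 4 * e by rewrite /e; field; rewrite gt_eqF.
lra.
Qed.

End MoscoMoreau.

Theorem theorem4p1 (R : realType) (H : metricType R)
  (f : H -> \bar R) (fn : nat -> H -> \bar R)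
  (hH : hadamard_space H)
  (hf : [/\ proper_fun f, convex_fun f & lower_semicontinuous f])
  (hfn : forall n, [/\ proper_fun (fn n), convex_fun (fn n)
                     & lower_semicontinuous (fn n)])
  (hM : mosco_cvg fn f) :
  forall (lambda : R) (x : H), 0 < lambda ->
    moreau_envelope (fn n) lambda x @[n --> \oo] --> moreau_envelope f lambda x
    /\ resolvent (fn n) lambda x @[n --> \oo] --> resolvent f lambda x.
Proof.
by move=> l x l0; split; [exact: moreau_envelope_cvg|exact: resolvent_cvg].
Qed.
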